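(* Let $C \subset \mathbb{Z}_{\ge 0}$ be a finite set. Then there exists a numerical monoid $S$ whose set of catenary degrees $\mathsf{C}(S)$ equals $C$ if and only if all of the following hold: (i) $0 \in C$, (ii) $1 \notin C$, and (iii) $\max C \ge 3$.
   Context: A numerical monoid $S$ is an additive submonoid of $\mathbb{Z}_{\ge 0}$ (containing $0$) with finite complement in $\mathbb{Z}_{\ge 0}$. It has a unique minimal generating set $n_1 < \cdots < n_k$, whose elements are called the atoms (irreducible elements) of $S$; one writes $S = \langle n_1, \ldots, n_k\rangle$. For $n \in S$, the set of factorizations of $n$ is $$\mathsf{Z}_S(n) = \{(a_1, \ldots, a_k) \in \mathbb{Z}_{\ge 0}^k : n = a_1 n_1 + \cdots + a_k n_k\}.$$ For $\mathbf{a} = (a_1, \ldots, a_k) \in \mathbb{Z}_{\ge 0}^k$ write $|\mathbf{a}| = a_1 + \cdots + a_k$. For $\mathbf{a}, \mathbf{a}' \in \mathsf{Z}_S(n)$ put $$\gcd(\mathbf{a}, \mathbf{a}') = (\min(a_1, a_1'), \ldots, \min(a_k, a_k')) \in \mathbb{Z}_{\ge 0}^k,$$ and define the distance $$\mathsf{d}(\mathbf{a}, \mathbf{a}') = \max\bigl(|\mathbf{a} - \gcd(\mathbf{a}, \mathbf{a}')|,\ |\mathbf{a}' - \gcd(\mathbf{a}, \mathbf{a}')|\bigr).$$ Given an integer $N \ge 0$, an $N$-chain from $\mathbf{a}$ to $\mathbf{a}'$ is a finite sequence $\mathbf{a} = \mathbf{a}_1, \mathbf{a}_2, \ldots, \mathbf{a}_r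 = \mathbf{a}'$ of elements of $\mathsf{Z}_S(n)$ such that $\mathsf{d}(\mathbf{a}_{i-1}, \mathbf{a}_i) \le N$ for all $2 \le i \le r$. The catenary degree $\mathsf{c}_S(n)$ of $n \in S$ is the smallest integer $N \ge 0$ such that there is an $N$-chain between any two factorizations of $n$ (in particular $\mathsf{c}_S(n) = 0$ if $n$ has only one factorization). The set of catenary degrees of $S$ is $$\mathsf{C}(S) = \{\mathsf{c}_S(n) : n \in S\}.$$
   Formalization: The numerical monoid S is required to be different from the whole of the non-negative integers, because that monoid has set of catenary degrees {0}, so that the equivalence as printed fails for C = {0}; no other set C is affected. *)

(* Defs.v *)
From mathcomp Require Import all_boot finmap.
From mathcomp Require Import boolp classical_sets functions cardinality.

Set Implicit Arguments.
Unset Strict Implicit.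
Unset Printing Implicit Defensive.

Local Open Scope classical_set_scope.
Local Open Scope nat_scope.

Definition numerical_monoid (S : set nat) : Prop :=
  [/\ S 0, forall m n, S m -> S n -> S (m + n) & finite_set (~` S)].

Definition is_atom (S : set nat) (n : nat) : Prop :=
  [/\ S n, n <> 0 &
      forall a b, S a -> S b -> n = a + b -> a = 0 \/ b = 0].

(* The increasing list n_1 < ... < n_k of the atoms. [fset_set] is a default
   value on infinite sets, but a numerical monoid has finitely many atoms, and
   they form its minimal generating set: see [mem_atoms], [atoms_generate] and
   [atoms_minimal] below. *)
Definition atoms (S : set nat) : seq nat :=
  sort leq (fset_set [set n | is_atom S n]).

Notation embdim S := (size (atoms S)).

Definition factorizations (S : set nat) (n : nat) :
    set {ffun 'I_(embdim S) -> nat} :=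
  [set a | n = \sum_(i < embdim S) a i * nth 0 (atoms S) i].
Arguments factorizations : clear implicits.

Section Vectors.
Variable k : nat.
Implicit Types a b : {ffun 'I_k -> nat}.

Definition vlen a : nat := \sum_(i < k) a i.
Definition vsub a b : {ffun 'I_k -> nat} := [ffun i => a i - b i].
Definition vgcd a b : {ffun 'I_k -> nat} := [ffun i => minn (a i) (b i)].
Definition vdist a b : nat :=
  maxn (vlen (vsub a (vgcd a b))) (vlen (vsub b (vgcd a b))).
End Vectors.

(* The chain is a :: s, so it has at least one term. *)
Definition has_chain (S : set nat) (n N : nat)
    (a b : {ffun 'I_(embdim S) -> nat}) : Prop :=
  exists s : seq {ffun 'I_(embdim S) -> nat},
    [/\ forall c, c \in a :: s -> factorizations S n c,
        path (fun x y => vdist x y <= N) a s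
      & last a s = b].
Arguments has_chain : clear implicits.

Definition chain_connected (S : set nat) (n N : nat) : Prop :=
  forall a b, factorizations S n a -> factorizations S n b ->
    has_chain S n N a b.

Lemma atoms_gt0 (S : set nat) (n : nat) : n \in atoms S -> 0 < n.
Proof.
rewrite /atoms mem_sort /fset_set; case: pselect => [fA|//].
case: cid => X /= XE nX.
have : [set` X] n by [].
by rewrite -XE => -[_ n0 _]; rewrite lt0n; apply/eqP.
Qed.

Lemma vlen_factorization (S : set nat) (n : nat) a :
  factorizations S n a -> vlen a <= n.
Proof.
move=> ->; apply: leq_sum => i _; apply: leq_pmulr.
by apply: (@atoms_gt0 S); apply: mem_nth.
Qed.

Lemma chain_connected_ex (S : set nat) (n : nat) :
  exists N, `[< chain_connected S n N >].
Proof.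
exists n; apply/asboolP => a b Za Zb; exists [:: b]; split => //.
  by move=> c; rewrite !inE => /orP[] /eqP ->.
rewrite /= andbT /vdist geq_max; apply/andP; split.
  apply: leq_trans (vlen_factorization Za).
  by apply: leq_sum => i _; rewrite ffunE leq_subr.
apply: leq_trans (vlen_factorization Zb).
by apply: leq_sum => i _; rewrite ffunE leq_subr.
Qed.

Definition catenary_degree (S : set nat) (n : nat) : nat :=
  ex_minn (chain_connected_ex S n).

(* For S = N, whose only atom is 1, this set is {0}; a proper numerical monoid
   always has an element of catenary degree at least 3. *)
Definition catenary_degrees (S : set nat) : set nat :=
  catenary_degree S @` S.

Lemma numerical_monoid_bound (S : set nat) : numerical_monoid S ->
  exists N, forall n, N <= n -> S n.
Proof.
case=> _ _ fS; exists (\max_(x <- fset_set (~` S)) x).+1 => n Nn.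
apply: contrapT => nSn.
have nX : n \in fset_set (~` S) by rewrite in_fset_set // inE.
by have := @leq_bigmax_seq _ (enum_fset (fset_set (~` S))) xpredT id n nX isT;
  rewrite leqNgt Nn.
Qed.

Lemma mem_atoms (S : set nat) (n : nat) : numerical_monoid S ->
  n \in atoms S <-> is_atom S n.
Proof.
move=> HS; have [N NS] := numerical_monoid_bound HS.
have fA : finite_set [set m | is_atom S m].
  apply: (@sub_finite_set _ _ `I_(N.+1 + N.+1)); last exact: finite_II.
  move=> m [Sm m0 irr] /=; rewrite ltnNge; apply/negP => Nm.
  have le1 : N.+1 <= m by apply: leq_trans Nm; apply: leq_addr.
  have Hb : N.+1 <= m - N.+1 by rewrite leq_subRL.
  have := irr N.+1 (m - N.+1) (NS _ (leqnSn N)) (NS _ (ltnW Hb)).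
  by rewrite subnKC // => /(_ erefl) [//|b0]; rewrite b0 in Hb.
by rewrite /atoms mem_sort in_fset_set // inE.
Qed.

Lemma atoms_sorted (S : set nat) : sorted ltn (atoms S).
Proof.
rewrite ltn_sorted_uniq_leq sort_uniq fset_uniq /=.
exact: (sort_sorted leq_total).
Qed.

Lemma atoms_generate (S : set nat) (n : nat) : numerical_monoid S ->
  S n <-> exists a, factorizations S n a.
Proof.
move=> HS; have [S0 SD _] := HS; split; last first.
  case=> a ->; apply: (big_ind S) => // i _.
  have Sg : S (nth 0 (atoms S) i).
    by have /(mem_atoms _ HS)[] : nth 0 (atoms S) i \in atoms S by apply: mem_nth.
  by elim: (a i) => [|m IH]; rewrite ?mul0n // mulSn; apply: SD.
elim/ltn_ind: n => n IH Sn.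
have [n0|n0] := eqVneq n 0.
  by exists [ffun=> 0]; rewrite /factorizations /= n0 big1 // => i _; rewrite ffunE.
have [/(mem_atoms _ HS) An|nA] := pselect (is_atom S n).
  have ltn : index n (atoms S) < embdim S by rewrite index_mem.
  exists [ffun i => (i == Ordinal ltn) : nat].
  rewrite /factorizations /= (bigD1 (Ordinal ltn)) //= ffunE eqxx mul1n nth_index //.
  by rewrite big1 ?addn0 // => i /negPf iN; rewrite ffunE iN.
have [a [b [Sa Sb nab a0 b0]]] : exists a b,
    [/\ S a, S b, n = a + b, a <> 0 & b <> 0].
  apply: contrapT => H; apply: nA; split => //; first exact/eqP.
  move=> a b Sa Sb nab; apply: contrapT => /not_orP[a0 b0].
  by apply: H; exists a, b.
have agt : 0 < a by rewrite lt0n; apply/eqP.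
have bgt : 0 < b by rewrite lt0n; apply/eqP.
have [|u ua] := IH a _ Sa; first by rewrite nab -[X in X < _]addn0 ltn_add2l.
have [|v vb] := IH b _ Sb; first by rewrite nab -[X in X < _]add0n ltn_add2r.
exists [ffun i => u i + v i]; rewrite /factorizations /= nab ua vb -big_split /=.
by apply: eq_bigr => i _; rewrite ffunE mulnDl.
Qed.

Lemma atoms_minimal (S G : set nat) : numerical_monoid S -> G `<=` S ->
  (forall n, S n -> exists2 s, {in s, forall x, G x} & n = sumn s) ->
  forall n, n \in atoms S -> G n.
Proof.
move=> HS GS gen n /(mem_atoms _ HS)[Sn n0 irr].
have [S0 SD _] := HS.
have [s] := gen n Sn.
elim: s => [|x s IH] sG //= nE.
have Gx : G x by apply: sG; rewrite mem_head.
have sG' : {in s, forall y, G y} by move=> y ys; apply: sG; rewrite inE ys orbT.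
have Ss : S (sumn s).
  elim: s sG' {IH sG nE} => //= y s IHs yG; apply: SD.
    by apply: GS; apply: yG; rewrite mem_head.
  by apply: IHs => z zs; apply: yG; rewrite inE zs orbT.
have [x0|s0] := irr _ _ (GS _ Gx) Ss nE.
  by apply: IH => //; rewrite nE x0.
by rewrite nE s0 addn0.
Qed.

(* Main.v *)
Require Import Defs.
From mathcomp Require Import all_boot finmap.
From mathcomp Require Import boolp classical_sets functions cardinality.
From mathcomp Require Import zify.

(* Necessity: two factorizations at distance at most 1 are equal, and a step of
   distance at most 2 preserves the length, while [x * y], for atoms [x <> y],
   has factorizations of the two lengths [x] and [y].

   Sufficiency: glue [T = p S + q N] with [1 < p < D], [p] and [q] coprime, [q]
   of a factorization of length [D] in [S], and [q > (D - 1) m], [m] being the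
   largest atom of [S].  The factorizations of [p s + q t], [t < p], split into
   layers, one for each [j] with [s - j q] in [S]; any two layers are at
   distance at least [D] since an element [>= q] of [S] has no factorization
   shorter than [D].  So if the degrees of [S] are at most [D], the degree in [T]
   is [D] when there are several layers, and the degree of [s] in [S] otherwise.
   The large elements of [C] are thus adjoined in increasing order with [p = 2],
   starting from [<c - 1, c>] (degrees 0, c), itself a gluing of [N], or from
   [<2c - 2, 2c - 1, 2c>] (degrees 0, 2, c). *)

Set Implicit Arguments.
Unset Strict Implicit.
Unset Printing Implicit Defensive.

Local Open Scope classical_set_scope.
Local Open Scope nat_scope.

(** * Factorizations as functions, and chains between them *)

(* Vectors of [N^k] are represented by functions [nat -> nat], whose values from
   [k] on are irrelevant; extending a vector by a coordinate is then [upd]. *)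
Definition len (k : nat) (a : nat -> nat) : nat := \sum_(i < k) a i.

Definition wt (g : seq nat) (a : nat -> nat) : nat :=
  \sum_(i < size g) a i * nth 0 g i.

(** Truncated subtraction already yields [a - gcd(a, b)], so [dist] involves no gcd. *)
Definition vminus (a b : nat -> nat) : nat -> nat := fun i => a i - b i.

Definition dist (k : nat) (a b : nat -> nat) : nat :=
  maxn (len k (vminus a b)) (len k (vminus b a)).

Inductive chain (g : seq nat) (n N : nat) : (nat -> nat) -> (nat -> nat) -> Prop :=
| chain_refl a : wt g a = n -> chain g n N a a
| chain_step a b c :
    wt g a = n -> dist (size g) a b <= N -> chain g n N b c -> chain g n N a c.

Definition conn (g : seq nat) (n N : nat) : Prop :=
  forall a b, wt g a = n -> wt g b = n -> chain g n N a b.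

Lemma wt_eq g a b : (forall i, i < size g -> a i = b i) -> wt g a = wt g b.
Proof. by move=> ab; apply: eq_bigr => i _; rewrite ab. Qed.

Lemma wtD g a b : wt g (fun i => a i + b i) = wt g a + wt g b.
Proof. by rewrite -big_split; apply: eq_bigr => i _; rewrite mulnDl. Qed.

Lemma lenD k a b : len k (fun i => a i + b i) = len k a + len k b.
Proof. exact: big_split. Qed.

Lemma wtZ g c a : wt g (fun i => c * a i) = c * wt g a.
Proof. by rewrite /wt big_distrr; apply: eq_bigr => i _; rewrite /= mulnA. Qed.

Lemma wt_single g i c : i < size g -> wt g (fun j => (j == i) * c) = c * nth 0 g i.
Proof.
move=> ig; rewrite /wt (bigD1 (Ordinal ig)) //= eqxx mul1n big1 ?addn0 // => j.
by rewrite -val_eqE /= => /negPf ->.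
Qed.

Lemma len_single k i c : i < k -> len k (fun j => (j == i) * c) = c.
Proof.
move=> ik; rewrite /len (bigD1 (Ordinal ik)) //= eqxx mul1n big1 ?addn0 // => j.
by rewrite -val_eqE /= => /negPf ->.
Qed.

(** Both sides are the weight of the coordinatewise maximum of [a] and [b]. For factorizations of
    one element, the two differences therefore have equal weight. *)
Lemma wt_minus g a b : wt g a + wt g (vminus b a) = wt g b + wt g (vminus a b).
Proof. by rewrite -!wtD; apply: wt_eq => i _; rewrite /vminus /=; lia. Qed.

Lemma len_minus k a b : len k a + len k (vminus b a) = len k b + len k (vminus a b).
Proof. by rewrite -!lenD; apply: eq_bigr => i _; rewrite /vminus; lia. Qed.

Lemma wt_le g m a : {in g, forall x, x <= m} -> wt g a <= len (size g) a * m.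
Proof.
move=> gm; rewrite /wt /len big_distrl; apply: leq_sum => i _ /=.
by rewrite leq_mul2l gm ?orbT // mem_nth.
Qed.

Lemma wt_gt0 g a : {in g, forall x, 0 < x} -> (0 < wt g a) = (0 < len (size g) a).
Proof.
move=> g0; rewrite !lt0n; congr (~~ _); rewrite !sum_nat_eq0.
by apply: eq_forallb => i; rewrite muln_eq0 [_ == 0 as X in _ || X]gtn_eqF ?orbF // g0 // mem_nth.
Qed.

Lemma len_eq0 k a : len k a = 0 -> forall i, i < k -> a i = 0.
Proof.
move=> /eqP; rewrite sum_nat_eq0 => /forallP H i ik.
exact/eqP/(H (Ordinal ik)).
Qed.

Lemma len_gt0 k a : 0 < len k a -> exists2 i, i < k & 0 < a i.
Proof.
rewrite lt0n sum_nat_eq0 negb_forall => /existsP[i]; rewrite -lt0n => ai.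
by exists i.
Qed.

Lemma distC k a b : dist k a b = dist k b a.
Proof. exact: maxnC. Qed.

Lemma dist_eq0 k a b : (forall i, i < k -> a i = b i) -> dist k a b = 0.
Proof.
move=> ab; apply/eqP; rewrite -leqn0 geq_max /len !leqn0 !sum_nat_eq0.
by apply/andP; split; apply/forallP => i; rewrite /vminus ab ?subnn.
Qed.

Lemma chain_trans g n N a b c : chain g n N a b -> chain g n N b c -> chain g n N a c.
Proof. by elim=> // x y z wx dxy _ IH /IH; apply: chain_step. Qed.

Lemma chain_wt g n N a b : chain g n N a b -> wt g a = n.
Proof. by case. Qed.

Lemma chain1 g n N a b :
  wt g a = n -> wt g b = n -> dist (size g) a b <= N -> chain g n N a b.
Proof. by move=> wa wb d; apply: chain_step d _ => //; apply: chain_refl. Qed.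

Lemma chain_sym g n N a b : chain g n N a b -> chain g n N b a.
Proof.
elim=> [x|x y z wx dxy cyz czy]; first exact: chain_refl.
by apply: chain_trans czy _; apply: chain1 => //; rewrite ?(chain_wt cyz) // distC.
Qed.

(** Changes the representative of a factorization: values from [size g] on do not count. *)
Lemma chain_ext g n N a b :
  wt g a = n -> (forall i, i < size g -> a i = b i) -> chain g n N a b.
Proof. by move=> wa ab; apply: chain1; rewrite ?dist_eq0 // -(wt_eq ab). Qed.

(** The source of all lower bounds on degrees: a quantity preserved by every step of size at most
    [N] must agree at both ends of an [N]-chain. *)
Lemma chain_inv g n N (P : (nat -> nat) -> Prop) a b :
  (forall x y, wt g x = n -> wt g y = n -> dist (size g) x y <= N -> P x -> P y) ->
  chain g n N a b -> P a -> P b.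
Proof.
move=> PI; elim=> // x y z wx dxy cyz IH Px; apply: IH.
by apply: (PI x y) => //; exact: chain_wt cyz.
Qed.

Lemma conn_mono g n N M : N <= M -> conn g n N -> conn g n M.
Proof.
move=> NM cN a b wa wb; elim: (cN a b wa wb) => [x|x y z wx dxy _].
  exact: chain_refl.
by apply: chain_step wx _; apply: leq_trans dxy NM.
Qed.

(** * Comparison with tuples indexed by the atoms *)

Definition restr k (a : nat -> nat) : {ffun 'I_k -> nat} := [ffun i : 'I_k => a i].

Definition extend k (a : {ffun 'I_k -> nat}) : nat -> nat :=
  fun i => oapp a 0 (insub i).

Lemma extendE k (a : {ffun 'I_k -> nat}) (i : 'I_k) : extend a i = a i.
Proof. by rewrite /extend valK. Qed.

Lemma extendK k : cancel (@extend k) (@restr k).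
Proof. by move=> a; apply/ffunP => i; rewrite ffunE extendE. Qed.

Lemma restrK k a i : i < k -> extend (restr k a) i = a i.
Proof. by move=> ik; rewrite -[i]/(val (Ordinal ik)) extendE ffunE. Qed.

Lemma vdistE k (a b : {ffun 'I_k -> nat}) : vdist a b = dist k (extend a) (extend b).
Proof.
by congr maxn; apply: eq_bigr => i _; rewrite !ffunE /vminus !extendE; lia.
Qed.

Lemma factorizationsE S n a : factorizations S n a <-> wt (atoms S) (extend a) = n.
Proof.
have -> : wt (atoms S) (extend a) = \sum_(i < embdim S) a i * nth 0 (atoms S) i.
  by apply: eq_bigr => i _; rewrite extendE.
by split => [->|<-].
Qed.

Lemma has_chainP S n N a b : has_chain S n N a b <->
  chain (atoms S) n N (extend a) (extend b).
Proof.
split=> [[s [Zs ps <-]]|].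
  elim: s a Zs ps => [|c s IH] a Zs /=.
    by move=> _; apply: chain_refl; apply/factorizationsE/Zs; rewrite mem_head.
  case/andP => dac ps; apply: chain_step (IH c _ ps).
  - by apply/factorizationsE/Zs; rewrite mem_head.
  - by rewrite -vdistE.
  - by move=> x xs; apply: Zs; rewrite inE xs orbT.
have H x y : chain (atoms S) n N x y ->
    has_chain S n N (restr (embdim S) x) (restr (embdim S) y).
  have Zr z : wt (atoms S) z = n -> factorizations S n (restr (embdim S) z).
    by move=> <-; apply/factorizationsE; apply: wt_eq => i ik; rewrite restrK.
  elim=> [z wz|z v w wz dzv _ [s [Zs ps ls]]].
    by exists [::]; split => // c; rewrite inE => /eqP ->; apply: Zr.
  exists (restr (embdim S) v :: s); split => //=.
    by move=> c; rewrite inE => /orP[/eqP ->|/Zs //]; apply: Zr.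
  rewrite ps andbT vdistE; apply: leq_trans dzv; rewrite leq_eqVlt; apply/orP; left.
  by apply/eqP; congr maxn; apply: eq_bigr => i _; rewrite /vminus !restrK.
by move/H; rewrite !extendK.
Qed.

Lemma chain_connectedP S n N : chain_connected S n N <-> conn (atoms S) n N.
Proof.
split=> cc a b => [wa wb|/factorizationsE Za /factorizationsE Zb]; last first.
  by apply/has_chainP; apply: cc.
have wr z : wt (atoms S) (extend (restr (embdim S) z)) = wt (atoms S) z.
  by apply: wt_eq => i ik; rewrite restrK.
have /has_chainP cab : has_chain S n N (restr _ a) (restr _ b).
  by apply: cc; apply/factorizationsE; rewrite wr.
apply: (@chain_trans _ _ _ _ (extend (restr (embdim S) a))).
  by apply: chain_ext => // i ik; rewrite restrK.
apply: chain_trans cab _.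
by apply: chain_ext => [|i ik]; rewrite ?wr ?restrK.
Qed.

Lemma catenary_degree_conn S n : conn (atoms S) n (catenary_degree S n).
Proof.
rewrite /catenary_degree; case: ex_minnP => N /asboolP cc _.
exact/chain_connectedP.
Qed.

Lemma catenary_degree_le S n N : conn (atoms S) n N -> catenary_degree S n <= N.
Proof.
rewrite /catenary_degree; case: ex_minnP => M _ minM /chain_connectedP cc.
by apply: minM; apply/asboolP.
Qed.

Lemma catenary_degree_eq S n N :
  conn (atoms S) n N -> (forall M, conn (atoms S) n M -> N <= M) ->
  catenary_degree S n = N.
Proof.
move=> cN minN; apply/eqP; rewrite eqn_leq catenary_degree_le //=.
exact/minN/catenary_degree_conn.
Qed.

Lemma mem_monoid S n : numerical_monoid S -> S n <-> exists a, wt (atoms S) a = n.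
Proof.
move=> HS; rewrite (atoms_generate n HS); split=> -[a Za].
  by exists (extend a); apply/factorizationsE.
exists (restr (embdim S) a); apply/factorizationsE.
by rewrite -Za; apply: wt_eq => i ik; rewrite restrK.
Qed.

Lemma atoms_eq S g : numerical_monoid S -> sorted ltn g ->
  (forall n, is_atom S n <-> n \in g) -> atoms S = g.
Proof.
move=> HS sg gS; apply: (irr_sorted_eq ltn_trans ltnn (atoms_sorted S) sg) => n.
by apply/idP/idP => [/(mem_atoms _ HS)/gS|/gS/(mem_atoms _ HS)].
Qed.

(** * Necessary conditions *)

(** The differences [a - b] and [b - a] have equal weight, so both are zero or both are a single
    generator. In the second case it is the same generator, although the supports are disjoint. *)
Lemma dist_le1 g a b : uniq g -> {in g, forall x, 0 < x} -> wt g a = wt g b ->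
  dist (size g) a b <= 1 -> forall i, i < size g -> a i = b i.
Proof.
move=> ug g0 wab; rewrite geq_max => /andP[dab dba].
have wE : wt g (vminus b a) = wt g (vminus a b).
  by have := wt_minus g a b; rewrite wab => /addnI.
have [e0|e0] := posnP (len (size g) (vminus a b)).
  have f0 : len (size g) (vminus b a) = 0.
    by apply/eqP; rewrite -leqn0 leqNgt -wt_gt0 // wE wt_gt0 // e0.
  move=> i ig; have := len_eq0 e0 ig; have := len_eq0 f0 ig; rewrite /vminus; lia.
have f0 : 0 < len (size g) (vminus b a) by rewrite -wt_gt0 // wE wt_gt0.
have sub1 c : len (size g) c <= 1 -> 0 < len (size g) c ->
    exists i : 'I_(size g), 0 < c i /\ wt g c = nth 0 g i.
  move=> c1 c0; have /eqP : len (size g) c = 1 by lia.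
  rewrite /len => /sum_nat_eq1[i [_ ci cj]]; exists i; split; first by rewrite ci.
  rewrite /wt (bigD1 i) //= ci mul1n big1 ?addn0 // => j /cj -> //.
have [i [ai wi]] := sub1 _ dab e0; have [j [bj wj]] := sub1 _ dba f0.
have ij : i = j :> nat by apply/eqP; rewrite -(nth_uniq 0 _ _ ug) // -wi -wj wE.
by move: ai bj; rewrite ij /vminus; lia.
Qed.

Lemma conn1_eq S n a b : conn (atoms S) n 1 -> wt (atoms S) a = n ->
  wt (atoms S) b = n -> forall i, i < embdim S -> a i = b i.
Proof.
move=> c1 wa wb i ik.
apply: (chain_inv (P := fun x => a i = x i) _ (c1 a b wa wb)) => // x y wx wy dxy ->.
apply: dist_le1 dxy _ ik; last by rewrite wx.
- by have := atoms_sorted S; rewrite ltn_sorted_uniq_leq => /andP[].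
- exact: atoms_gt0.
Qed.

Lemma catenary_degree_neq1 S n : catenary_degree S n <> 1.
Proof.
move=> c1; suff : catenary_degree S n <= 0 by rewrite c1.
apply: catenary_degree_le => a b wa wb; apply: chain_ext => //.
by apply: conn1_eq wa wb; rewrite -c1; apply: catenary_degree_conn.
Qed.

Lemma catenary_degree0 S : catenary_degree S 0 = 0.
Proof.
apply/eqP; rewrite -leqn0; apply: catenary_degree_le => a b wa wb.
have z c : wt (atoms S) c = 0 -> forall i, i < size (atoms S) -> c i = 0.
  by move=> wc; apply: len_eq0; apply/eqP;
     rewrite -leqn0 leqNgt -wt_gt0 ?wc //; apply: atoms_gt0.
by apply: chain_ext => // i ig; rewrite (z a) ?(z b).
Qed.

(** Removing one atom from a factorization of length at least 2 leaves a nonzero element, which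
    splits [x]. *)
Lemma wt_atom S a x : numerical_monoid S -> is_atom S x -> wt (atoms S) a = x ->
  len (embdim S) a <= 1.
Proof.
move=> HS [_ x0 irr] wa; rewrite leqNgt; apply/negP => l1.
have [j jS aj] := len_gt0 (ltnW l1).
set d := fun i => (i == j) * 1; set a' := vminus a d.
have ad i : a i = d i + a' i by rewrite /a' /d /vminus; case: eqP => [->|]; lia.
have wE : x = nth 0 (atoms S) j + wt (atoms S) a'.
  by rewrite -[X in X + _]mul1n -wt_single // -wtD -wa; apply: wt_eq => i _; rewrite ad.
have lE : len (embdim S) a = 1 + len (embdim S) a'.
  by rewrite -[X in X + _](len_single 1 jS) -big_split; apply: eq_bigr => i _; rewrite ad.
have jA : nth 0 (atoms S) j \in atoms S by rewrite mem_nth.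
have a'0 : 0 < wt (atoms S) a' by rewrite wt_gt0 //; [rewrite lE in l1|exact: atoms_gt0].
have := atoms_gt0 jA.
have /(mem_atoms _ HS)[Sj _ _] := jA.
have Sa' : S (wt (atoms S) a') by apply/mem_monoid => //; exists a'.
by have := irr _ _ Sj Sa' wE; lia.
Qed.

(** The two differences have equal weight and length at most 2. Length 0 means weight 0, and length
    1 means that the weight is an atom, so the two lengths agree. *)
Lemma dist_le2_len S a b : numerical_monoid S ->
  wt (atoms S) a = wt (atoms S) b -> dist (embdim S) a b <= 2 ->
  len (embdim S) a = len (embdim S) b.
Proof.
move=> HS wab; rewrite geq_max => /andP[dab dba].
have wE : wt (atoms S) (vminus b a) = wt (atoms S) (vminus a b).
  by have := wt_minus (atoms S) a b; rewrite wab => /addnI.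
have key c d : wt (atoms S) c = wt (atoms S) d ->
    len (embdim S) c <= 1 -> len (embdim S) d <= len (embdim S) c.
  move=> wcd c1; have [c0|c0] := posnP (len (embdim S) c).
    rewrite leqNgt c0 -wt_gt0 -?wcd ?wt_gt0 ?c0 //; exact: atoms_gt0.
  have {}c1 : len (embdim S) c == 1 by lia.
  rewrite (eqP c1).
  have [i [_ ci cj]] := sum_nat_eq1 _ _ c1.
  have Ai : is_atom S (nth 0 (atoms S) i) by apply/mem_atoms => //; rewrite mem_nth.
  apply: (wt_atom HS Ai); rewrite -wcd /wt (bigD1 i) //= ci mul1n.
  by rewrite big1 ?addn0 // => j /cj -> //.
have eE : len (embdim S) (vminus b a) = len (embdim S) (vminus a b).
  have := key _ _ wE; have := key _ _ (esym wE); move: dab dba.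
  move: (len _ (vminus a b)) (len _ (vminus b a)) => e f e2 f2 ef fe.
  by case: (leqP e 1) (leqP f 1) => [/ef|] ? [/fe|] ?; lia.
by have := len_minus (embdim S) a b; rewrite eE => /addIn.
Qed.

Lemma two_atoms S : numerical_monoid S -> S <> [set: nat] ->
  exists x y, [/\ x \in atoms S, y \in atoms S & x <> y].
Proof.
move=> HS SN; have [S0 SD _] := HS; have [N NS] := numerical_monoid_bound HS.
have atom_not_dvd d n : S n -> ~~ (d %| n) -> exists2 x, x \in atoms S & ~~ (d %| x).
  case/mem_monoid => // a <-; apply: contraNP => /forall2NP H.
  apply: dvdn_sum => i _; apply: dvdn_mull; apply: contraT => ni.
  by have [] := H (nth 0 (atoms S) i); rewrite ?mem_nth.
(* The divisor [N.+2] only serves to produce some atom; the next use, with divisor [x], gives an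
   atom different from it. *)
have [||x xA _] := atom_not_dvd N.+2 N.+1; first exact: NS.
  by apply/negP => /dvdn_leq; lia.
have /(mem_atoms _ HS)[Sx _ _] := xA; have x0 := atoms_gt0 xA.
have x1 : x <> 1.
  move=> x1; apply: SN; apply/seteqP; split=> // n _.
  by elim: n => // n Sn; rewrite -addn1; apply: SD; rewrite // -x1.
have [||y yA xy] := atom_not_dvd x (x * N).+1.
- by apply: NS; nia.
- by rewrite -addn1 dvdn_addr ?dvdn_mulr // dvdn1; apply/eqP.
by exists x, y; split => // E; rewrite -E dvdnn in xy.
Qed.

Lemma catenary_degree_ge3 S : numerical_monoid S -> S <> [set: nat] ->
  exists2 n, S n & 3 <= catenary_degree S n.
Proof.
move=> HS /(two_atoms HS)[x [y [xA yA xy]]].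
have mem z c : z \in atoms S ->
    let a := fun j => (j == index z (atoms S)) * c in
    wt (atoms S) a = c * z /\ len (embdim S) a = c.
  move=> zA /=; rewrite wt_single ?index_mem // nth_index //; split => //.
  by rewrite len_single ?index_mem.
have [wx lx] := mem x y xA; have [wy ly] := mem y x yA.
exists (y * x); first by apply/mem_monoid => //; eexists; exact: wx.
rewrite leqNgt; apply/negP => c2; apply: xy; rewrite mulnC in wy.
apply: etrans (esym ly) _; apply: etrans lx.
apply: (chain_inv (P := fun z => len (embdim S) _ = len (embdim S) z) _
  (catenary_degree_conn wy wx)) => // u v wu wv duv ->.
by apply: dist_le2_len => //; [rewrite wu|apply: leq_trans duv _].
Qed.

(** * Gluing *)

Definition gluing (S : set nat) (p q : nat) : set nat :=
  [set n | exists s t, S s /\ n = p * s + q * t].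

Definition upd (k t : nat) (a : nat -> nat) : nat -> nat :=
  fun i => if i == k then t else a i.

Lemma wt_upd g k t a : size g <= k -> wt g (upd k t a) = wt g a.
Proof.
by move=> gk; apply: wt_eq => i ig; rewrite /upd ltn_eqF // (leq_trans ig).
Qed.

Lemma wt_rcons g p q a :
  wt (rcons [seq p * x | x <- g] q) a = p * wt g a + q * a (size g).
Proof.
rewrite /wt size_rcons big_ord_recr /= nth_rcons size_map ltnn eqxx.
congr (_ + _); last exact: mulnC.
rewrite big_distrr; apply: eq_bigr => i _.
by rewrite /= nth_rcons size_map ltn_ord (nth_map 0) // mulnCA.
Qed.

Lemma distS k a b :
  dist k.+1 a b = maxn (len k (vminus a b) + (a k - b k))
                       (len k (vminus b a) + (b k - a k)).
Proof. by rewrite /dist /len !big_ord_recr. Qed.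

(** The number of copies of [q] is determined modulo [p]; its possible values index the layers. *)
Lemma congr_mod_glue p q s t s' t' : coprime p q ->
  p * s + q * t = p * s' + q * t' -> t = t' %[mod p].
Proof.
move=> pq; wlog: s t s' t' / t <= t' => [H|tt'] E.
  by case/orP: (leq_total t t') => tt'; [apply: (H s t s' t')|apply/esym/(H s' t' s t)].
apply/esym/eqP; rewrite eqn_mod_dvd // -(Gauss_dvdr _ pq) mulnBr.
have -> : q * t' - q * t = p * (s - s') by rewrite mulnBr; lia.
exact: dvdn_mulr.
Qed.

Section Glue.
Variables (g : seq nat) (p q D m : nat).
Hypotheses (p1 : 1 < p) (pD : p < D) (pq : coprime p q).
Hypotheses (gm : {in g, forall x, x <= m}) (mq : D.-1 * m < q).
(** Coordinate [k] counts the copies of the new generator [q]; those before it form a vector over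
    [g]. *)
Let k := size g.
Let g' := rcons [seq p * x | x <- g] q.

Let size_g' : size g' = k.+1. Proof. by rewrite size_rcons size_map. Qed.

Lemma chain_glue n N t a b :
  chain g n N a b -> chain g' (p * n + q * t) N (upd k t a) (upd k t b).
Proof.
have wu c : wt g c = n -> wt g' (upd k t c) = p * n + q * t.
  by move=> wc; rewrite wt_rcons wt_upd // wc /upd eqxx.
elim=> [x /wu|x y z /wu wx dxy _]; first exact: chain_refl.
apply: chain_step wx _; apply: leq_trans dxy.
rewrite size_g' distS /upd eqxx subnn !addn0 leq_eqVlt; apply/orP; left; apply/eqP.
by congr maxn; apply: eq_bigr => i _; rewrite /vminus ltn_eqF.
Qed.

(** Here [y k = x k + p * j] with [j > 0], so over [g] the part [x - y] weighs at least [q]. As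
    [q > D.-1 * m], it uses at least [D] generators. *)
Lemma dist_glue_ge x y : wt g' x = wt g' y -> x k < y k -> D <= dist (size g') x y.
Proof.
rewrite !wt_rcons -/k => E xy.
have /eqP := congr_mod_glue pq E; rewrite eq_sym eqn_mod_dvd ?(ltnW xy) //.
case/dvdnP=> j jE; have j0 : 0 < j by case: j jE => //; lia.
have {jE} yE : y k = x k + p * j by lia.
have wE : wt g x = wt g y + q * j by apply/eqP; rewrite -(eqn_pmul2l (ltnW p1)); lia.
have wq : q <= wt g (vminus x y).
  by have := wt_minus g x y; have := leq_pmulr q j0; lia.
rewrite leqNgt size_g' distS gtn_max; apply/negP => /andP[lD _].
have := leq_trans wq (wt_le (vminus x y) gm); rewrite -/k leqNgt => /negP; apply.
by apply: leq_ltn_trans mq; rewrite leq_mul2r; apply/orP; right; lia.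
Qed.

Variable u : nat -> nat.
Hypotheses (wu : wt g u = q) (lu : len k u = D).
Hypothesis gD : forall n, conn g n D.

(** Bring both factorizations to the same layer, then use a [D]-chain over [g] inside it. *)
Lemma conn_glue n : conn g' n D.
Proof.
(* Each move trades [p] copies of [q] for the [D] scaled generators of [u], both of weight [p * q];
   its distance is [maxn D p = D]. *)
have step j b : wt g' b = n -> p * j <= b k -> 
    chain g' n D (upd k (b k - p * j) (fun i => b i + j * u i)) b.
  move=> wb; rewrite wt_rcons -/k in wb.
  have wE i c : wt g' (upd k c (fun l => b l + i * u l)) = p * (wt g b + i * q) + q * c.
    by rewrite wt_rcons wt_upd // wtD wtZ wu /upd eqxx.
  elim: j => [|j IH] jb.
    apply: chain_ext => [|i _].
      by rewrite wE -wb; lia.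
    by rewrite /upd; case: eqP => [->|]; lia.
  apply: chain_trans (IH _); last by lia.
  apply: chain1; [rewrite wE -wb; nia|rewrite wE -wb; nia|].
  have e1 : len k (vminus (upd k (b k - p * j.+1) (fun i => b i + j.+1 * u i))
    (upd k (b k - p * j) (fun i => b i + j * u i))) = D.
    rewrite -lu; apply: eq_bigr => i _; rewrite /vminus /upd ltn_eqF //; lia.
  have e2 : len k (vminus (upd k (b k - p * j) (fun i => b i + j * u i))
    (upd k (b k - p * j.+1) (fun i => b i + j.+1 * u i))) = 0.
    by apply: big1 => i _; rewrite /vminus /upd ltn_eqF //; lia.
  by rewrite size_g' distS e1 e2 /upd eqxx; lia.
suff H a b : a k <= b k -> wt g' a = n -> wt g' b = n -> chain g' n D a b.
  move=> a b wa wb; case/orP: (leq_total (a k) (b k)) => /H; first exact.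
  by move=> /(_ wb wa)/chain_sym.
move=> ab wa wb; have E : wt g' a = wt g' b by rewrite wa.
rewrite !wt_rcons -/k in E; have /eqP := congr_mod_glue pq E.
rewrite eq_sym eqn_mod_dvd // => /dvdnP[j jE].
apply: chain_trans (step j b wb _); last by lia.
have bE : b k = a k + p * j by lia.
have -> : b k - p * j = a k by rewrite bE addnK.
rewrite bE in E.
have wE : wt g a = wt g b + q * j by apply/eqP; rewrite -(eqn_pmul2l (ltnW p1)); lia.
apply: (@chain_trans _ _ _ _ (upd k (a k) a)).
  by apply: chain_ext => // i _; rewrite /upd; case: eqP => [->|].
rewrite -wa wt_rcons -/k; apply: chain_glue; apply: gD => //.
by rewrite wtD wtZ wu wE mulnC.
Qed.

Lemma conn_glue_ge n a b M :
  wt g' a = n -> wt g' b = n -> a k != b k -> conn g' n M -> D <= M.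
Proof.
move=> wa wb ab cM; rewrite leqNgt; apply/negP => MD; move/eqP: ab; apply.
apply: (chain_inv (P := fun x => a k = x k) _ (cM a b wa wb)) => // x y wx wy dxy ->.
have dD := leq_ltn_trans dxy MD.
have [xy|yx|//] := ltngtP (x k) (y k).
  by have := dist_glue_ge (etrans wx (esym wy)) xy; rewrite leqNgt dD.
by have := dist_glue_ge (etrans wy (esym wx)) yx; rewrite leqNgt distC dD.
Qed.

(** When [s - q] is not a weight there is one layer, [a k = t]. Adding or dropping this constant
    coordinate turns chains over [g] into chains over [g'] and back. *)
Lemma conn_glue_layer s t M : t < p ->
  (forall r, wt g r + q <> s) -> conn g' (p * s + q * t) M <-> conn g s M.
Proof.
move=> tp sq.
have layer a : wt g' a = p * s + q * t -> a k = t /\ wt g a = s.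
  rewrite wt_rcons -/k => E; have := congr_mod_glue pq E; rewrite (modn_small tp) => at_.
  have aE := divn_eq (a k) p; rewrite at_ in aE; move: aE.
  case: (a k %/ p) => [|j] aE.
    rewrite {1}aE; split=> //; apply/eqP; rewrite -(eqn_pmul2l (ltnW p1)); move: E.
    by rewrite {1}aE; lia.
  (* If [a k = t + p * j.+1], turning [j] of the blocks of [p] copies of [q] into copies of [u]
     exhibits [s - q] as a weight. *)
  case: (sq (fun i => a i + j * u i)); rewrite wtD wtZ wu; apply/eqP.
  rewrite -(eqn_pmul2l (ltnW p1)); move: E; rewrite aE; nia.
split=> cM a b wa wb.
  have wE c : wt g c = s -> wt g' (upd k t c) = p * s + q * t.
    by move=> wc; rewrite wt_rcons wt_upd // wc /upd eqxx.
  have ue c i : i < size g -> upd k t c i = c i by rewrite /upd => ig; rewrite ltn_eqF.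
  have proj x y : chain g' (p * s + q * t) M x y -> chain g s M x y.
    elim=> [z /layer[_ wz]|z v w /layer[_ wz] dzv _]; first exact: chain_refl.
    apply: chain_step wz _; apply: leq_trans dzv; rewrite size_g' distS.
    by rewrite geq_max !leq_max !leq_addr ?orbT.
  have /proj cab := cM _ _ (wE a wa) (wE b wb).
  apply: chain_trans (chain_trans _ cab) _; apply: chain_ext; rewrite ?wt_upd // => i ig.
    by rewrite ue.
  by rewrite ue.
have [at_ was] := layer a wa; have [bt wbs] := layer b wb.
have ue c i : c k = t -> upd k t c i = c i by rewrite /upd; case: eqP => [->|].
apply: chain_trans (chain_trans _ (chain_glue t (cM a b was wbs))) _.
  by apply: chain_ext => // i _; rewrite ue.
by apply: chain_ext => [|i _]; rewrite ?ue // -wb; apply: wt_eq => i _; rewrite ue.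
Qed.

End Glue.

(** * The glued monoid, its atoms and its degrees *)

Lemma cofinite_bound (S : set nat) N : (forall n, N <= n -> S n) -> finite_set (~` S).
Proof.
move=> NS; apply: (@sub_finite_set _ _ `I_N); last exact: finite_II.
by move=> n nS /=; rewrite ltnNge; apply/negP => /NS.
Qed.

Lemma glue_monoid S p q : numerical_monoid S -> 0 < p -> coprime p q ->
  numerical_monoid (gluing S p q).
Proof.
move=> HS p0 pq; have [S0 SD _] := HS; have [N NS] := numerical_monoid_bound HS.
split.
- by exists 0, 0; rewrite !muln0.
- move=> _ _ [s [t [Ss ->]]] [s' [t' [Ss' ->]]].
  by exists (s + s'), (t + t'); split; [exact: SD|lia].
(* The remainder theorem gives [t < p] with [q * t] congruent to [n] modulo [p]; the bound leaves
   [n - q * t] at least [p * N], hence [p] times an element of [S]. *)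
apply: (@cofinite_bound _ (p * N + q * p)) => n nN.
pose t := chinese p q n 0 %/ q %% p.
have qt : q * (chinese p q n 0 %/ q) = chinese p q n 0.
  rewrite mulnC divnK // /dvdn; have := chinese_modr pq n 0.
  by rewrite mod0n => ->.
have tn : n = q * t %[mod p] by rewrite modnMmr qt chinese_modl.
have tp : t < p by rewrite ltn_mod.
have qtn : q * t <= n by have := leq_mul (leqnn q) (ltnW tp); lia.
have /eqP := tn; rewrite eqn_mod_dvd // => /dvdnP[s sE].
exists s, t; split; last by lia.
by apply: NS; rewrite -(leq_pmul2l p0); have := leq_mul (leqnn q) (ltnW tp); lia.
Qed.

(** Elements of the gluing below [q] are multiples of [p]. Hence [q], coprime to [p], is not a sum
    of two of them, and splitting [p * x < q] amounts to splitting [x] in [S]. *)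
Lemma glue_atoms S p q : numerical_monoid S -> S q -> 1 < p -> coprime p q ->
  {in atoms S, forall x, p * x < q} ->
  atoms (gluing S p q) = rcons [seq p * x | x <- atoms S] q.
Proof.
move=> HS Sq p1 pq gq; have p0 := ltnW p1.
have HT := glue_monoid HS p0 pq; have [S0 SD _] := HS.
have q0 : 0 < q by case: q pq {Sq gq HT} => //; rewrite /coprime gcdn0; lia.
have small n : gluing S p q n -> n < q -> exists2 s, S s & n = p * s.
  move=> [s [[|t] [Ss ->]]]; first by exists s; rewrite // muln0 addn0.
  by rewrite mulnS; lia.
have Tp s : S s -> gluing S p q (p * s) by move=> Ss; exists s, 0; rewrite muln0 addn0.
apply: atoms_eq => //.
  rewrite (sorted_pairwise ltn_trans) pairwise_rcons -(sorted_pairwise ltn_trans).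
  apply/andP; split; first by rewrite all_map; apply/allP => x /gq.
  by apply: homo_sorted (atoms_sorted S) => x y; rewrite ltn_pmul2l.
move=> n; rewrite mem_rcons inE; split.
  move=> [[s [t [Ss nE]]] n0 irr]; apply/orP.
  case: t nE => [|t] nE; last first.
    left; have Tq : gluing S p q q by exists 0, 1; rewrite muln0 muln1.
    have Tr : gluing S p q (p * s + q * t) by exists s, t.
    by have [|//|r0] := irr _ _ Tq Tr; [rewrite nE; lia|lia|rewrite nE; apply/eqP; lia].
  right; rewrite nE muln0 addn0; apply: map_f; apply/mem_atoms => //; split=> //.
    by move=> s0; apply: n0; rewrite nE s0 !muln0.
  move=> a b Sa Sb sE; have [||] := irr _ _ (Tp a Sa) (Tp b Sb); first by lia.
    by move/eqP; rewrite muln_eq0 gtn_eqF //= => /eqP; left.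
  by move/eqP; rewrite muln_eq0 gtn_eqF //= => /eqP; right.
case/orP => [/eqP ->|/mapP[x xA ->]].
  split; [by exists 0, 1; rewrite muln0 muln1|by lia|] => a b Ta Tb qE.
  have [a0|a0] := eqVneq a 0; [by left|right]; apply: contrapT => b0.
  have [s _ aE] := small a Ta ltac:(lia); have [r _ bE] := small b Tb ltac:(lia).
  have pdq : p %| q by rewrite qE aE bE -mulnDr dvdn_mulr.
  by move: pq; rewrite /coprime (gcdn_idPl pdq); lia.
have /(mem_atoms _ HS)[Sx x0 irr] := xA.
split; [exact: Tp|by move/eqP; rewrite muln_eq0 gtn_eqF //= => /eqP|].
move=> a b Ta Tb abE; have := gq _ xA => xq.
have [s Ss aE] := small a Ta ltac:(lia); have [r Sr bE] := small b Tb ltac:(lia).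
rewrite aE bE; have [|s0|r0] := irr s r Ss Sr; [|by left; rewrite s0 muln0|by right; rewrite r0 muln0].
by apply/eqP; rewrite -(eqn_pmul2l p0) abE aE bE mulnDr.
Qed.

Lemma glue_catenary S p q D m u : numerical_monoid S -> 1 < p < D -> coprime p q ->
  {in atoms S, forall x, x <= m} -> D.-1 * m < q ->
  wt (atoms S) u = q -> len (embdim S) u = D ->
  (forall s, S s -> catenary_degree S s <= D) ->
  [/\ numerical_monoid (gluing S p q),
      atoms (gluing S p q) = rcons [seq p * x | x <- atoms S] q,
      forall s t, S s -> t < p -> (forall r, S r -> r + q <> s) ->
        catenary_degree (gluing S p q) (p * s + q * t) = catenary_degree S s
    & forall s t, S s -> t < p ->
        catenary_degree (gluing S p q) (p * (s + q) + q * t) = D].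
Proof.
move=> HS /andP[p1 pD] pq gm mq wu lu cD.
have Sq : S q by apply/mem_monoid => //; exists u.
have gq : {in atoms S, forall x, p * x < q}.
  by move=> x /gm xm; apply: leq_ltn_trans mq; apply: leq_mul; lia.
have AT := glue_atoms HS Sq p1 pq gq; have HT := glue_monoid HS (ltnW p1) pq.
have gD n : conn (atoms S) n D.
  move=> a b wa wb; have Sn : S n by apply/mem_monoid => //; exists a.
  by apply: (conn_mono (cD _ Sn) (@catenary_degree_conn S n)).
split=> // [s t Ss tp sq|s t Ss tp].
  have H M := conn_glue_layer p1 pD pq mq wu lu M tp
    (fun r => sq _ (proj2 (mem_monoid _ HS) (ex_intro _ r erefl))).
  apply: catenary_degree_eq; rewrite AT; first exact/H/catenary_degree_conn.
  by move=> M /H; apply: catenary_degree_le.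
apply: catenary_degree_eq; rewrite AT; first exact: (@conn_glue _ _ _ _ _ p1 pD pq mq _ wu lu gD).
have /(mem_monoid _ HS)[a wa] := Ss.
(* Two layers are occupied: [u] together with [t] copies of [q], or [p + t] copies of [q], each
   added to a factorization of [s]. *)
move=> M; apply: (@conn_glue_ge _ _ _ _ _ p1 pD pq gm mq _
  (upd (embdim S) t (fun i => a i + u i)) (upd (embdim S) (p + t) a)).
- by rewrite wt_rcons wt_upd // wtD wa wu /upd eqxx.
- by rewrite wt_rcons wt_upd // wa /upd eqxx; lia.
- by rewrite /upd eqxx; lia.
Qed.

(** * Realization *)

(* The bound [M * m] on where the degrees occur keeps these elements below the
   element [q > M * m] of the next gluing, hence their degrees unchanged. *)
Definition realizes (S C : set nat) (M m : nat) : Prop :=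
  [/\ numerical_monoid S, catenary_degrees S = C, forall c, C c -> c <= M,
      m \in atoms S /\ {in atoms S, forall x, x <= m}
    & forall c, C c -> exists s, [/\ S s, s <= M * m & catenary_degree S s = c]].

Lemma realizes_glue S C M m p q D u : realizes S C M m ->
  M < D -> 1 < p < D -> coprime p q -> D.-1 * m < q ->
  wt (atoms S) u = q -> len (embdim S) u = D ->
  realizes (gluing S p q) (D |` C) D q /\
  atoms (gluing S p q) = rcons [seq p * x | x <- atoms S] q.
Proof.
move=> [HS CE CM [mA mmax] CR] MD pD pq mq wu lu.
have cC s : S s -> C (catenary_degree S s) by move=> Ss; rewrite -CE; exists s.
have cD s : S s -> catenary_degree S s <= D.
  by move=> Ss; apply: leq_trans (ltnW MD); apply/CM/cC.
have Sq : S q by apply/mem_monoid => //; exists u.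
have [HT AT cT1 cT2] := glue_catenary HS pD pq mmax mq wu lu cD.
have /andP[p1 pDD] := pD; have [S0 Sadd _] := HS.
have real c : (D |` C) c -> exists s,
    [/\ gluing S p q s, s <= D * q & catenary_degree (gluing S p q) s = c].
  (* Degree [D] occurs at [p * q]. An old degree occurs at [p * s] with
     [s <= M * m <= D.-1 * m < q], where there is a single layer. *)
  case=> [->|/CR[s [Ss sM sc]]].
    exists (p * (0 + q) + q * 0); rewrite cT2 ?(ltnW p1) //; split=> //.
      by exists (0 + q), 0.
    by rewrite muln0 addn0 add0n leq_mul2r (ltnW pDD) orbT.
  have sq : s < q.
    by apply: leq_ltn_trans mq; apply: leq_trans sM _; rewrite leq_mul2r; apply/orP; right; lia.
  exists (p * s + q * 0); rewrite cT1 ?(ltnW p1) //; last by move=> r _; lia.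
  by split=> //; [exists s, 0|rewrite muln0 addn0; apply: leq_mul; lia].
split=> //; split=> //.
- apply/seteqP; split=> [_ [n [s [t [Ss ->]]] <-]|c /real[s [Ts _ <-]]]; last by exists s.
  (* Since [q] lies in [S], whole blocks of [p] copies of [q] are absorbed into [s], leaving fewer
     than [p] copies. *)
  have -> : p * s + q * t = p * (s + q * (t %/ p)) + q * (t %% p).
    by rewrite {1}(divn_eq t p); lia.
  have tp : t %% p < p by rewrite ltn_mod ltnW.
  have {}Ss : S (s + q * (t %/ p)).
    apply: (Sadd _ _ Ss); elim: (t %/ p) => [|j IH]; first by rewrite muln0.
    by rewrite mulnS; apply: Sadd.
  move: (s + _) Ss => {}s Ss.
  have [[r [Sr <-]]|nr] := pselect (exists r, S r /\ r + q = s).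
    by rewrite cT2 //; left.
  by rewrite cT1 //; [right; apply: cC|move=> r Sr rs; apply: nr; exists r].
- by move=> c [->|/CM] //; lia.
- rewrite AT mem_rcons mem_head; split=> // x; rewrite mem_rcons inE.
  case/orP => [/eqP -> //|/mapP[y /mmax ym ->]].
  by apply: ltnW; apply: leq_ltn_trans mq; apply: leq_mul; lia.
Qed.

(** The invariant behind repeated gluing with [p = 2]: it allows an odd [q] to be chosen, and the
    new atoms again include the odd [q] and even numbers. *)
Definition both_parities (g : seq nat) : Prop :=
  (exists2 x, x \in g & odd x) /\ (exists2 x, x \in g & ~~ odd x).

Lemma wt_two g i j c d : i < size g -> j < size g ->
  let a := fun l => (l == i) * c + (l == j) * d in
  wt g a = c * nth 0 g i + d * nth 0 g j /\ len (size g) a = c + d.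
Proof.
by move=> ig jg; rewrite /= wtD lenD !wt_single ?len_single.
Qed.

Lemma realizes_add S C M m D : realizes S C M m -> both_parities (atoms S) ->
  M < D -> 2 < D -> exists T m', realizes T (D |` C) D m' /\ both_parities (atoms T).
Proof.
move=> RS [[x xA xo] [y yA ye]] MD D2.
have [_ _ _ [mA mmax] _] := RS.
(* Take [q = D.-1 * m + z], a sum of [D] atoms exceeding [D.-1 * m], with the parity of [z] making
   [q] odd; [z] may be [m] itself. *)
have [z zA zo] : exists2 z, z \in atoms S & odd (D.-1 * m + z).
  case E : (odd (D.-1 * m)); [exists y|exists x]; rewrite // oddD E ?xo //.
have z0 := atoms_gt0 zA.
have ig : index m (atoms S) < embdim S by rewrite index_mem.
have jg : index z (atoms S) < embdim S by rewrite index_mem.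
have [wu lu] := wt_two D.-1 1 ig jg; rewrite !nth_index // mul1n in wu.
have [||||RT AT] := @realizes_glue _ _ _ _ 2 _ D _ RS MD _ _ _ wu.
- by [].
- by rewrite coprime2n.
- by lia.
- by rewrite lu; lia.
exists (gluing S 2 (D.-1 * m + z)), (D.-1 * m + z); split=> //.
rewrite AT; split; first by exists (D.-1 * m + z); rewrite ?mem_rcons ?mem_head.
exists (2 * m); last by rewrite oddM.
by rewrite mem_rcons inE map_f ?orbT.
Qed.

Lemma realizes_seq s S C M m : realizes S C M m -> both_parities (atoms S) ->
  1 < M -> path ltn M s ->
  exists T M' m', realizes T (C `|` [set` s]) M' m'.
Proof.
elim: s S C M m => [|D s IH] S C M m RS bp M1 /=.
  by exists S, M, m; rewrite set_nil setU0.
move=> /andP[MD ps]; have [T [m' [RT bT]]] := realizes_add RS bp MD (leq_ltn_trans M1 MD).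
have [T' [M' [m'' RT']]] := IH T _ D m' RT bT (ltn_trans M1 MD) ps.
exists T', M', m''; congr realizes: RT'; apply/seteqP; split=> x /=; rewrite inE.
  by case=> [[->|Cx]|xs]; [right; rewrite eqxx|left|right; rewrite xs orbT].
by case=> [Cx|/orP[/eqP ->|xs]]; [left; right|left; left|right].
Qed.

(** * The initial monoids *)

Lemma numerical_monoid_setT : numerical_monoid [set: nat].
Proof. by split=> //; apply: (@cofinite_bound _ 0). Qed.

Lemma atoms_setT : atoms [set: nat] = [:: 1].
Proof.
apply: atoms_eq numerical_monoid_setT _ _ => //.
move=> n; rewrite inE; split=> [[_ n0 irr]|/eqP -> ].
  by have [| |] := irr 1 n.-1 I I; lia.
by split=> // a b _ _; lia.
Qed.

Lemma realizes_setT : realizes [set: nat] [set 0] 0 1.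
Proof.
have c0 n : catenary_degree [set: nat] n = 0.
  apply/eqP; rewrite -leqn0; apply: catenary_degree_le; rewrite atoms_setT => a b wa wb.
  apply: chain_ext => // -[|//] _; move: wa wb.
  by rewrite /wt !big_ord1 /= !muln1 => -> ->.
split.
- exact: numerical_monoid_setT.
- by apply/seteqP; split=> [_ [n _ <-]|_ ->] /=; [rewrite c0|exists 0].
- by move=> _ ->.
- by rewrite atoms_setT mem_head; split=> // x; rewrite inE => /eqP ->.
- by move=> _ ->; exists 0.
Qed.

(** Glue the monoid of all naturals with [p = c.-1] and [q = c], where [u] is [c] copies of the atom
    1; the required bound reads [c.-1 * 1 < c]. *)
Lemma realizes_consecutive c : 2 < c -> exists S,
  realizes S (c |` [set 0]) c c /\ both_parities (atoms S).
Proof.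
move=> c2; exists (gluing [set: nat] c.-1 c).
have [||||||RS AS] := @realizes_glue _ _ _ _ c.-1 c c (fun=> c) realizes_setT.
- by lia.
- by lia.
- by rewrite coprimePn //; lia.
- by rewrite muln1; lia.
- by rewrite atoms_setT /wt big_ord1 /= muln1.
- by rewrite atoms_setT /len big_ord1.
split=> //; rewrite AS atoms_setT /= muln1.
have cE : odd c = ~~ odd c.-1 by case: c c2 {RS AS}.
by case E: (odd c.-1); split; [exists c.-1|exists c|exists c|exists c.-1];
  rewrite ?cE ?E ?inE ?eqxx ?orbT.
Qed.

(** * The monoid generated by [2 * d], [2 * d + 1] and [2 * d + 2] *)

Section Interval.
Variable d : nat.
Hypothesis d1 : 1 < d.
Let g := [:: 2 * d; (2 * d).+1; (2 * d).+2].

(* [<2d, 2d + 1, 2d + 2>]: a sum of [L] generators is [2d L + w] with [w <= 2 L]. *)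
Definition interval_monoid : set nat :=
  [set n | exists L w, w <= 2 * L /\ n = 2 * d * L + w].
Let S := interval_monoid.

Lemma interval_monoidP : numerical_monoid S.
Proof.
split.
- by exists 0, 0; lia.
- by move=> _ _ [L [w [wL ->]]] [L' [w' [wL' ->]]]; exists (L + L'), (w + w'); lia.
(* From here on the quotient by [2 * d] is at least [d], so twice it exceeds the remainder. *)
apply: (@cofinite_bound _ (2 * d * d)) => n nd.
exists (n %/ (2 * d)), (n %% (2 * d)); split; last by rewrite mulnC -divn_eq.
have : n %% (2 * d) < 2 * d by rewrite ltn_mod; lia.
have : d <= n %/ (2 * d) by rewrite leq_divRL; lia.
lia.
Qed.

(** Nonzero elements are at least [2 * d], and [4 * d > 2 * d + 2], so no generator is a sum of two
    of them. *)
Lemma atoms_interval : atoms S = g.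
Proof.
have S1 i : i <= 2 -> S (2 * d + i) by move=> i2; exists 1, i; lia.
have S0 n : S n -> n = 0 \/ 2 * d <= n.
  by move=> [[|L] [w [wL ->]]]; [left; lia|right; rewrite mulnS; lia].
apply: atoms_eq interval_monoidP _ _; first by rewrite /= !ltnSn.
move=> n; split=> [[[L [w [wL nE]]] n0 irr]|].
  have [i i2 Sr] : exists2 i, i <= 2 & exists r, S r /\ n = 2 * d + i + r.
    case: L wL nE => [|L] wL nE; first lia.
    (* Splitting off the generator with the largest possible offset keeps the rest of the offset
       within twice the remaining length. *)
    exists (minn 2 w); first by lia.
    exists (2 * d * L + (w - minn 2 w)); split; last by lia.
    by exists L, (w - minn 2 w); lia.
  have [r [Sr' rE]] := Sr; have [|r0] := irr _ _ (S1 i i2) Sr' rE; first by lia.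
  rewrite rE r0 addn0 !inE; lia.
rewrite !inE => nE; split.
- have -> : n = 2 * d + (n - 2 * d) by lia.
  by apply: S1; lia.
- by lia.
- by move=> a b /S0 a0 /S0 b0; lia.
Qed.

Let vec x y z : nat -> nat := nth 0 [:: x; y; z].

Let len3 a : len 3 a = a 0 + a 1 + a 2.
Proof. by rewrite /len !big_ord_recr big_ord0. Qed.

Let wtE a : wt g a = 2 * d * len 3 a + (a 1 + 2 * a 2).
Proof. by rewrite len3 /wt /g /= !big_ord_recr big_ord0 /=; lia. Qed.

Let distE a b : dist (size g) a b =
  maxn (a 0 - b 0 + (a 1 - b 1) + (a 2 - b 2)) (b 0 - a 0 + (b 1 - a 1) + (b 2 - a 2)).
Proof. by rewrite /dist /= !len3. Qed.

Lemma interval_chain_len n N a b : 2 <= N -> wt g a = n -> wt g b = n ->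
  len 3 a = len 3 b -> chain g n N a b.
Proof.
move=> N2; wlog ab : a b / a 2 <= b 2 => [H|] wa wb lab.
  by case/orP: (leq_total (a 2) (b 2)) => h; [|apply: chain_sym]; apply: H.
have [j jE] : exists j, b 2 = a 2 + j by exists (b 2 - a 2); lia.
elim: j a wa lab jE {ab} => [|j IH] a wa lab jE.
  have h : a 1 + 2 * a 2 = b 1 + 2 * b 2.
    by move: wa; rewrite -wb !wtE lab => /addnI.
  rewrite !len3 in lab.
  by apply: chain_ext => // -[|[|[|//]]] _; lia.
have h : a 1 + 2 * a 2 = b 1 + 2 * b 2.
  by move: wa; rewrite -wb !wtE lab => /addnI.
have lab' := lab; rewrite !len3 in lab'.
(* Two copies of [2 * d + 1] become one [2 * d] and one [2 * d + 2], at distance 2; [a 1 >= 2]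
   because [a 2 < b 2]. *)
have lv : len 3 (vec (a 0).+1 (a 1 - 2) (a 2).+1) = len 3 a by rewrite !len3 /vec /=; lia.
have wv : wt g (vec (a 0).+1 (a 1 - 2) (a 2).+1) = n by rewrite -wa !wtE lv /vec /=; lia.
apply: chain_step wa _ (IH _ wv _ _); [|by rewrite lv|rewrite /vec /=; lia].
by rewrite distE /vec /=; lia.
Qed.

(* [d] copies of [2d + 2] are traded for [d + 1] copies of [2d]; a factorization
   that is not of maximal length can be brought, keeping its length, to one with
   [d] copies of [2d + 2]. *)
Lemma interval_conn n : conn g n d.+1.
Proof.
move=> a b; wlog ab : a b / len 3 a <= len 3 b => [H|] wa wb.
  by case/orP: (leq_total (len 3 a) (len 3 b)) => h; [|apply: chain_sym]; apply: H.
have [j jE] : exists j, len 3 b = len 3 a + j by exists (len 3 b - len 3 a); lia.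
elim: j a wa jE {ab} => [|j IH] a wa jE; first by apply: interval_chain_len; lia.
set w := a 1 + 2 * a 2.
have wd : 2 * d <= w.
  by move: wa; rewrite -wb !wtE jE -/w mulnDr mulnS; lia.
have wL : w <= 2 * len 3 a by rewrite len3 /w; lia.
(* With the length fixed, [w = 2 * z + y] gives the factorization with the most copies of
   [2 * d + 2], namely [z >= d]. *)
have w2 := divn_eq w 2; have wm : w %% 2 < 2 by rewrite ltn_mod.
move: (w %/ 2) (w %% 2) w2 wm => z y w2 wm.
have lv : len 3 (vec (len 3 a - z - y) y z) = len 3 a by rewrite len3 /vec /=; lia.
have wv : wt g (vec (len 3 a - z - y) y z) = n.
  by rewrite -wa [RHS]wtE wtE lv -/w w2 /vec /=; lia.
apply: (@chain_trans _ _ _ _ (vec (len 3 a - z - y) y z)).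
  by apply: interval_chain_len => //; rewrite ?lv; lia.
have lv' : len 3 (vec (len 3 a - z - y + d.+1) y (z - d)) = (len 3 a).+1.
  by rewrite len3 /vec /=; lia.
have wv' : wt g (vec (len 3 a - z - y + d.+1) y (z - d)) = n.
  by rewrite -wv !wtE lv lv' /vec /= mulnS; lia.
apply: chain_step wv _ (IH _ wv' _); last by rewrite lv'; lia.
by rewrite distE /vec /=; lia.
Qed.

(** Let [x = a - b] and [y = b - a]. Equal weights and [len y > len x] force the offset of [x], at
    most [2 * len x], to be at least [2 * d]; so [len x >= d] and [len y > d]. *)
Lemma interval_dist_ge a b : wt g a = wt g b -> len 3 a < len 3 b ->
  d < dist (size g) a b.
Proof.
move=> wab lab; rewrite leq_max; apply/orP; right.
have := wt_minus g a b; rewrite wab => /addnI; rewrite !wtE.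
have := len_minus 3 a b; rewrite /= !len3; move: lab; rewrite !len3.
by rewrite /vminus; nia.
Qed.

Lemma interval_conn_ge n a b M : wt g a = n -> wt g b = n -> len 3 a != len 3 b ->
  conn g n M -> d < M.
Proof.
move=> wa wb lab cM; rewrite ltnNge; apply/negP => Md; move/eqP: lab; apply.
apply: (chain_inv (P := fun x => len 3 a = len 3 x) _ (cM a b wa wb)) => // x y wx wy dxy ->.
have dd := leq_trans dxy Md; have [xy|yx|//] := ltngtP (len 3 x) (len 3 y).
  by have := interval_dist_ge (etrans wx (esym wy)) xy; rewrite ltnNge dd.
by have := interval_dist_ge (etrans wy (esym wx)) yx; rewrite ltnNge distC dd.
Qed.

Lemma realizes_interval :
  realizes S [set` [:: 0; 2; d.+1]] d.+1 (2 * d).+2 /\ both_parities (atoms S).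
Proof.
have AS := atoms_interval; have HS := interval_monoidP.
have cat n : catenary_degree S n \in [:: 0; 2; d.+1].
  (* Factorizations of different lengths give degree [d.+1]; otherwise the degree is at most 2, and
     it is never 1. *)
  have [[a [b [wa wb lab]]]|H] := pselect (exists a b,
      [/\ wt g a = n, wt g b = n & len 3 a != len 3 b]).
    have -> : catenary_degree S n = d.+1; last by rewrite !inE eqxx !orbT.
    apply: catenary_degree_eq; rewrite AS; first exact: interval_conn.
    by move=> M; apply: interval_conn_ge wa wb lab.
  have := @catenary_degree_neq1 S n; suff : catenary_degree S n <= 2.
    by case: catenary_degree => [|[|[|]]] //; rewrite !inE eqxx orbT.
  apply: catenary_degree_le; rewrite AS => a b wa wb; apply: interval_chain_len => //.
  by apply/eqP; apply: contra_notT H => lab; exists a, b.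
have real c : c \in [:: 0; 2; d.+1] ->
    exists s, [/\ S s, s <= d.+1 * (2 * d).+2 & catenary_degree S s = c].
  rewrite !inE => /or3P[] /eqP ->.
  - by exists 0; rewrite catenary_degree0; split=> //; have [] := HS.
  (* All factorizations have length 2, and there are two of them: the middle generator twice, or
     both outer ones. *)
  - exists (4 * d + 2); split; [by exists 2, 2; lia|by nia|].
    apply/eqP; rewrite eqn_leq; apply/andP; split.
      apply: catenary_degree_le; rewrite AS => a b wa wb; apply: interval_chain_len => //.
      move: wa wb; rewrite !wtE !len3 => wa wb.
      have key x y z : 2 * d * (x + y + z) + (y + 2 * z) = 4 * d + 2 -> x + y + z = 2 by nia.
      by rewrite (key _ _ _ wa) (key _ _ _ wb).
    rewrite ltnNge; apply/negP => c1.
    have := conn_mono c1 (@catenary_degree_conn S (4 * d + 2)).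
    move=> /conn1_eq => /(_ (vec 0 2 0) (vec 1 0 1)); rewrite AS !wtE !len3 /vec /=.
    by move=> /(_ ltac:(lia) ltac:(lia) 0 isT).
  (* This is [d.+1] copies of [2 * d], and also [d] copies of [2 * d + 2]. *)
  - exists (2 * d * d.+1); split; [by exists d.+1, 0; lia|by nia|].
    apply: catenary_degree_eq; rewrite AS; first exact: interval_conn.
    move=> M; apply: (interval_conn_ge (a := vec d.+1 0 0) (b := vec 0 0 d)).
    - by rewrite wtE len3 /vec /=; lia.
    - by rewrite wtE len3 /vec /=; lia.
    - by rewrite !len3 /vec /=; lia.
split; first split=> //.
- by apply/seteqP; split=> [_ [n _ <-]|c /real[s [Ss _ <-]]]; [apply: cat|exists s].
- by move=> c /=; rewrite !inE; lia.
- by rewrite AS; split=> [|x]; rewrite !inE ?eqxx ?orbT //; lia.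
rewrite AS; split; [exists (2 * d).+1|exists (2 * d)];
  by rewrite ?inE ?eqxx ?orbT //= oddM.
Qed.

End Interval.

(** * The characterization of the sets of catenary degrees *)

Theorem theorem4p2 (C : {fset nat}) :
  (exists S : set nat,
     [/\ numerical_monoid S, S <> [set: nat]
       & catenary_degrees S = [set` C]])
  <-> [/\ 0 \in C, 1 \notin C & 3 <= \max_(c <- C) c].
Proof.
split=> [[S [HS SN SC]]|[C0 C1 C3]].
  have CE n : S n -> catenary_degree S n \in C.
    by move=> Sn; suff : [set` C] (catenary_degree S n) by []; rewrite -SC; exists n.
  split.
  - by rewrite -(catenary_degree0 S); apply: CE; have [] := HS.
  - apply/negP => C1; have : catenary_degrees S 1 by rewrite SC.
    by case=> n _ /catenary_degree_neq1.
  - have [n Sn n3] := catenary_degree_ge3 HS SN; apply: leq_trans n3 _.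
    exact: (@leq_bigmax_seq _ (enum_fset C) xpredT id _ (CE n Sn) isT).
have big c : c \in C -> 2 < c -> c \in [seq c <- sort leq C | 2 < c].
  by move=> cC c2; rewrite mem_filter c2 mem_sort.
have [c cC c2] : exists2 c, c \in C & 2 < c.
  apply: contrapT => noc; suff : \max_(c <- C) c <= 2 by lia.
  apply/bigmax_leqP_seq => c cC _; rewrite leqNgt; apply/negP => c2.
  by apply: noc; exists c.
have sC x : x \in [seq c <- sort leq C | 2 < c] = (2 < x) && (x \in C).
  by rewrite mem_filter mem_sort.
(* The elements above 2 in increasing order: the least, [c0], goes into the initial monoid, and the
   others are adjoined by gluing. *)
have : sorted ltn [seq c <- sort leq C | 2 < c].
  apply: sorted_filter; first exact: ltn_trans.
  by rewrite ltn_sorted_uniq_leq sort_uniq fset_uniq (sort_sorted leq_total).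
case E : [seq c <- sort leq C | 2 < c] => [|c0 s] /= ps.
  by have := sC c; rewrite E cC c2.
have c02 : 2 < c0 by have := sC c0; rewrite E mem_head => /esym/andP[].
have [S [B [m [RS bS BE]]]] : exists S B m, [/\ realizes S B c0 m,
    both_parities (atoms S) & forall x, B x <-> x \in c0 :: [seq c <- [:: 0; 2] | c \in C]].
  have [C2|C2] := boolP (2 \in C).
    exists (interval_monoid c0.-1), [set` [:: 0; 2; c0.-1.+1]], (2 * c0.-1).+2.
    have [|RS bS] := @realizes_interval c0.-1; first lia.
    rewrite prednK in RS *; last lia; split=> // x /=.
    by rewrite C0 C2 !inE; split=> /or3P[] ->; rewrite ?orbT.
  have [S [RS bS]] := realizes_consecutive c02.
  exists S, (c0 |` [set 0]), c0; split=> // x /=; rewrite C0 (negPf C2) !inE.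
  by split=> [[->|->]|/orP[] /eqP ->]; rewrite ?eqxx ?orbT; [| |left|right].
have [T [M' [m' RT]]] := realizes_seq RS bS (ltnW c02) ps.
have [HT TE _ _ _] := RT.
have TC x : (B `|` [set` s]) x <-> x \in C.
  have := sC x; rewrite E /= BE !inE mem_filter !inE => sx.
  split=> [[/orP[/eqP xc|/andP[] //]|xs]|Cx].
  - by move: sx; rewrite xc eqxx => /esym/andP[].
  - by move: sx; rewrite xs orbT => /esym/andP[].
  move: sx; rewrite Cx andbT; have [_ /orP[->|xs]|x2 _] := ltnP 2 x.
  - by left.
  - by right.
  left; case: x x2 Cx => [|[|[|//]]] // _ Cx.
  - by rewrite orbT.
  - by rewrite Cx in C1.
  - by rewrite orbT.
exists T; split=> //.
  (* The monoid of all naturals has only degree 0, while [c > 2] is a degree of [T]. *)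
  move=> TN; have : (B `|` [set` s]) c by apply/TC.
  by have [_ NE _ _ _] := realizes_setT; rewrite -TE TN NE => c0'; rewrite c0' in c2.
by rewrite TE; apply/seteqP; split=> x /TC.
Qed.
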